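(* Let $q(n)=an^2+bn+c$ be a quadratic polynomial with integer coefficients and positive leading coefficient $a$. For each prime $p$ let $m_q(p)=\sup\{k\in\mathbb{N}\cup\{0\}: q(n)\equiv 0 \pmod{p^k}\text{ has an integer solution } n\}$ (possibly $\infty$). Let $p_n$ denote the $n$-th prime, and let $r$ be the least positive integer such that $m_q(p_r)=\infty$ (such $r$ exists). Then there are infinitely many practical numbers of the form $q(n)$ with $n\in\mathbb{N}$ if and only if $p_1^{m_q(p_1)}p_2^{m_q(p_2)}\cdots p_{r-1}^{m_q(p_{r-1})}\,p_r$ is a practical number.
   Context: A positive integer $N$ is called a practical number if every integer in $[1,N]$ can be expressed as a sum of distinct positive divisors of $N$. *)

(* Defs.v *)
From mathcomp Require Import all_boot all_order all_algebra.
Set Implicit Arguments. Unset Strict Implicit. Unset Printing Implicit Defensive.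
Import GRing.Theory Num.Theory.

Definition practical (N : nat) : Prop :=
  0 < N /\
  forall m : nat, 1 <= m <= N ->
    exists s : seq nat, [/\ uniq s, all (fun d => (0 < d) && (d %| N)) s & sumn s = m].

Definition quad (a b c : int) (n : int) : int := (a * n ^+ 2 + b * n + c)%R.

Definition solvable_mod (a b c : int) (p k : nat) : Prop :=
  exists n : int, ((p ^ k)%:Z %| quad a b c n)%Z.

Definition mq_infinite (a b c : int) (p : nat) : Prop :=
  forall k : nat, solvable_mod a b c p k.

Definition mq_is (a b c : int) (p k : nat) : Prop :=
  solvable_mod a b c p k /\ forall j : nat, solvable_mod a b c p j -> j <= k.

(* Main.v *)
Require Import Defs.
From mathcomp Require Import all_boot all_order all_algebra.
From mathcomp Require Import zify ring.
From Stdlib Require Import Classical_Prop.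

(** A practical [N >= p] has [p <= sigma M + 1] as soon as [M] is a multiple of all
    divisors of [N] below [p]; taking [N = q(n)] this gives Stewart's criterion for the product.

    Conversely let [L = M P^k] be practical with [L | q(x0)], and use
    [q(n + t q(n)) = q(n) (1 + t q'(n) + a t^2 q(n))].  If the discriminant [D] is nonzero, put
    [S = |t^2 D - 1|]: modulo [S] the number [-1/t] is a square root of [D], so some [beta]
    satisfies both [q(beta) = 0] and [1 + t q'(beta) = 0] modulo [S], and [S] divides both factors
    whenever [n = beta] mod [S].  Choosing also [n = x0] mod [L] and [L S <= n < 2 L S], we get
    [q(n) = L S x] and second factor [S z] with [x <= L S^2] and [z <= L S^2 x] once [t] is large
    compared to the coefficients.  Since [m w] is practical for [m] practical and [w <= m],
    the product [L S S x z] is practical.  If [D = 0], take [t = 2]: the second factor is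
    [(1 + q'(n))^2], and all primes dividing the product are at most [1 + q'(n)], which is below
    [L S^2] when [S] divides [1 + q'(n)]. *)

(** * Sums of distinct divisors, and products that stay practical *)

Definition divisor_sum (N m : nat) : Prop :=
  exists s : seq nat, [/\ uniq s, all (fun d => (0 < d) && (d %| N)) s & sumn s = m].

Definition sigma (m : nat) : nat := sumn (divisors m).

(** The range up to [sigma m], the largest possible divisor sum, is what can be propagated through
    an induction over prime factors; [complete_practical] then returns to the range up to [m]. *)
Definition complete (m : nat) : Prop := forall j, j <= sigma m -> divisor_sum m j.

Lemma sumn_mulr (x : nat) (s : seq nat) : sumn [seq d * x | d <- s] = sumn s * x.
Proof. by elim: s => //= d s ->; rewrite mulnDl. Qed.

Lemma mem_leq_sumn (d : nat) (s : seq nat) : d \in s -> d <= sumn s.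
Proof.
elim: s => //= e s IH; rewrite inE => /orP[/eqP->|/IH]; first exact: leq_addr.
by move=> h; apply: leq_trans h _; apply: leq_addl.
Qed.

Lemma sumn_sub_uniq (s t : seq nat) : uniq s -> {subset s <= t} -> sumn s <= sumn t.
Proof.
move=> us st; rewrite !sumnE (perm_big _ (_ : perm_eq s [seq x <- undup t | x \in s])).
  rewrite big_filter; apply: leq_trans (_ : \sum_(i <- undup t) i <= _).
    by rewrite big_mkcond; apply: leq_sum => i _; case: ifP.
  elim: t {st} => //= x t IH; case: ifP => _; rewrite ?big_cons ?leq_add2l //.
  by rewrite (leq_trans IH) ?leq_addl.
apply: uniq_perm => //; first by rewrite filter_uniq ?undup_uniq.
by move=> x; rewrite mem_filter mem_undup; case xs: (x \in s) => //=; rewrite st.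
Qed.

Lemma divisor_sum0 (N : nat) : divisor_sum N 0.
Proof. by exists [::]. Qed.

(** Scale the divisors of [m] summing to [i] by [x] and append the divisors of [n] summing to [r].
    The two lists must be disjoint, and only entries [e <= r] need checking, since no entry exceeds
    its sum. *)
Lemma divisor_sumMD (N m n x i r : nat) :
  0 < x -> m * x %| N -> n %| N ->
  (forall d e, 0 < d -> d %| m -> 0 < e -> e %| n -> e <= r -> d * x != e) ->
  divisor_sum m i -> divisor_sum n r -> divisor_sum N (i * x + r).
Proof.
move=> x0 mN nN dis [s [us /allP ds <-]] [t [ut /allP dt tr]].
exists ([seq d * x | d <- s] ++ t); split; last by rewrite sumn_cat sumn_mulr tr.
  rewrite cat_uniq ut andbT map_inj_uniq ?us /=; last first.
    by move=> d e /eqP; rewrite eqn_pmul2r // => /eqP.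
  apply/hasPn => e et; apply/mapP => -[d dins ede].
  have /andP[d0 dm] := ds _ dins; have /andP[e0 en] := dt _ et.
  by move: (dis d e d0 dm e0 en); rewrite -tr mem_leq_sumn // ede eqxx => /(_ isT).
apply/allP => e; rewrite mem_cat => /orP[/mapP[d dins ->]|/dt /andP[-> en]].
  have /andP[d0 dm] := ds _ dins.
  by rewrite muln_gt0 d0 x0 (dvdn_trans _ mN) // dvdn_mul.
by rewrite (dvdn_trans en).
Qed.

Lemma practical_sum (N m : nat) : practical N -> m <= N -> divisor_sum N m.
Proof.
move=> [_ H]; case: m => [|m] mN; first exact: divisor_sum0.
by apply: H.
Qed.

(** Division of the target by [x] leaves a quotient and a remainder that are both at most [m].
    Scaled divisors are at least [x], hence above the remainder, so no divisor occurs twice. *)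
Lemma practical_mul (m x : nat) : practical m -> 0 < x <= m -> practical (m * x).
Proof.
move=> pm /andP[x0 xm]; split; first by rewrite muln_gt0 pm.1.
move=> j /andP[_ jmx]; rewrite (divn_eq j x).
have rx := ltn_pmod j x0.
apply: (@divisor_sumMD _ m m) => //.
- exact: dvdn_mulr.
- move=> d e d0 _ _ _ er; rewrite neq_ltn; apply/orP; right.
  by apply: leq_ltn_trans er _; apply: leq_trans rx _; rewrite leq_pmull.
- by apply: practical_sum => //; rewrite -[m](mulnK _ x0) leq_div2r.
- by apply: practical_sum => //; apply: leq_trans (ltnW rx) xm.
Qed.

(** Only the prime factors of [x] are bounded, not [x] itself: they are multiplied in one at a time,
    and [m] grows meanwhile. *)
Lemma practical_mul_smooth (m x : nat) :
  practical m -> 0 < x -> (forall p, prime p -> p %| x -> p <= m) -> practical (m * x).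
Proof.
elim/ltn_ind: x m => x IH m pm x0 H.
have [x1|x1] := leqP x 1; first by have -> : x = 1 by [lia]; rewrite muln1.
have pp := pdiv_prime x1; have pd := pdiv_dvd x.
have p0 := prime_gt0 pp.
rewrite -(divnK pd) [_ %/ _ * _]mulnC mulnA; apply: IH.
- by rewrite ltn_Pdiv // prime_gt1.
- by apply: practical_mul => //; rewrite p0 H.
- by rewrite divn_gt0 // dvdn_leq.
- move=> p pr pdx; apply: leq_trans (_ : m <= _); last by rewrite leq_pmulr.
  by apply: H => //; apply: dvdn_trans pdx _; apply: dvdn_div.
Qed.

Lemma practical_mul_expn (m p k : nat) :
  0 < p -> practical (m * p) -> practical (m * p ^ k.+1).
Proof.
move=> p0 pm; elim: k => [|k IH]; first by rewrite expn1.
rewrite expnSr mulnA; apply: practical_mul => //.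
rewrite p0 expnSr mulnA leq_pmull // muln_gt0 expn_gt0 p0 andbT.
by move: pm.1; rewrite muln_gt0 => /andP[].
Qed.

(** * Divisor sums under multiplication by prime powers *)

Lemma coprime_pfactor_ndvd (m p k d : nat) :
  prime p -> 0 < m -> coprime m p -> 0 < d -> d %| m -> ~~ (d * p ^ k.+1 %| m * p ^ k).
Proof.
move=> pp m0 cmp d0 dm; rewrite expnS mulnA dvdn_pmul2r ?expn_gt0 ?prime_gt0 //.
move: cmp; rewrite coprime_sym prime_coprime //; apply: contra.
exact: dvdn_trans (dvdn_mull d (dvdnn p)).
Qed.

(** The divisors of [m * p ^ k.+1] split according to whether [p] occurs to the full power [k.+1] or
    to at most [k]. *)
Lemma sigma_mul_pfactor (m p k : nat) :
  prime p -> 0 < m -> coprime m p ->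
  sigma (m * p ^ k.+1) = sigma m * p ^ k.+1 + sigma (m * p ^ k).
Proof.
move=> pp m0 cmp; have p0 := prime_gt0 pp.
have e0 i : 0 < m * p ^ i by rewrite muln_gt0 m0 expn_gt0 p0.
rewrite /sigma -sumn_mulr -sumn_cat; apply: perm_sumn; apply: uniq_perm.
- exact: divisors_uniq.
- rewrite cat_uniq divisors_uniq andbT map_inj_uniq ?divisors_uniq /=; last first.
    by move=> d e /eqP; rewrite eqn_pmul2r ?expn_gt0 ?p0 // => /eqP.
  apply/hasPn => e; rewrite -dvdn_divisors // => ed; apply/mapP => -[d].
  rewrite -dvdn_divisors // => dm ede; move: ed; apply/negP; rewrite ede.
  by rewrite coprime_pfactor_ndvd // (dvdn_gt0 m0).
move=> d; rewrite mem_cat -!dvdn_divisors //; apply/idP/orP.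
  move=> dd; have d0 : 0 < d by apply: dvdn_gt0 dd.
  have [v cpv dv] := pfactor_coprime pp d0.
  have vm : v %| m.
    rewrite -(@Gauss_dvdl _ _ (p ^ k.+1)) ?coprimeXr 1?coprime_sym //.
    by apply: dvdn_trans dd; rewrite [X in _ %| X]dv dvdn_mulr.
  have [lk|kl] := leqP (logn p d) k; [right|left].
    by rewrite {1}dv dvdn_mul // dvdn_exp2l.
  apply/mapP; exists v; rewrite -?dvdn_divisors // {1}dv; congr (_ * p ^ _).
  have := dvdn_leq_log p (e0 k.+1) dd.
  have -> : logn p (m * p ^ k.+1) = k.+1.
    by rewrite lognM ?expn_gt0 ?p0 // pfactorK // logn_coprime // coprime_sym.
  by move=> h; apply/eqP; rewrite eqn_leq h.
case=> [/mapP[v]|dd]; last by apply: dvdn_trans dd _; rewrite dvdn_mul // dvdn_exp2l.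
by rewrite -dvdn_divisors // => vm ->; rewrite dvdn_mul.
Qed.

Lemma complete_mul_pfactor (m p k : nat) :
  prime p -> 0 < m -> coprime m p -> p <= (sigma m).+1 -> complete m ->
  complete (m * p ^ k).
Proof.
move=> pp m0 cmp ps cm.
(* The second conjunct strengthens the induction: remainders up to [sigma (m * p ^ k)] fill every
   gap between consecutive multiples of [p ^ k.+1]. *)
suff [] : complete (m * p ^ k) /\ p ^ k.+1 <= (sigma (m * p ^ k)).+1 by [].
elim: k => [|k [IH1 IH2]]; first by rewrite expn0 expn1 muln1.
have x0 : 0 < p ^ k.+1 by rewrite expn_gt0 prime_gt0.
rewrite /complete sigma_mul_pfactor //; split; last by rewrite (expnS p k.+1); nia.
move=> j jle.
have [i [r [-> ile rle]]] :
    exists i r, [/\ j = i * p ^ k.+1 + r, i <= sigma m & r <= sigma (m * p ^ k)].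
  (* Euclidean division works unless the quotient exceeds [sigma m]. Then [i] is capped at
     [sigma m], and the bound on [j] keeps the rest within [sigma (m * p ^ k)]. *)
  have [h|h] := leqP (j %/ p ^ k.+1) (sigma m).
    exists (j %/ p ^ k.+1), (j %% p ^ k.+1); split=> //; first exact: divn_eq.
    by have := ltn_pmod j x0; lia.
  exists (sigma m), (j - sigma m * p ^ k.+1).
  have := divn_eq j (p ^ k.+1); split=> //; nia.
apply: (@divisor_sumMD _ m (m * p ^ k)) => //.
- by rewrite dvdn_mul // dvdn_exp2l.
- move=> d e d0 dm _ en _; apply: contraTneq en => <-.
  exact: coprime_pfactor_ndvd.
- exact: cm.
- exact: IH1.
Qed.

Lemma complete_practical (m : nat) : 0 < m -> complete m -> practical m.
Proof.
move=> m0 cm; split=> // j /andP[_ jm]; apply: cm; apply: leq_trans jm _.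
by apply: mem_leq_sumn; rewrite -dvdn_divisors.
Qed.

(** Otherwise [sigma M + 1] is below [p], so it is a sum of distinct divisors of [N] below [p].
    These all divide [M], so their sum is at most [sigma M]. *)
Lemma practical_sigma_bound (N M p : nat) :
  practical N -> 0 < M -> p <= N ->
  (forall d, 0 < d -> d %| N -> d < p -> d %| M) -> p <= (sigma M).+1.
Proof.
move=> pN M0 pleN H; rewrite leqNgt; apply/negP => hlt.
have [|s [us /allP ds ss]] := practical_sum _ _ pN (_ : (sigma M).+1 <= N); first by lia.
suff : sumn s <= sigma M by lia.
apply: sumn_sub_uniq => // d dins; have /andP[d0 dN] := ds _ dins.
by rewrite -dvdn_divisors //; apply: H => //; have := mem_leq_sumn _ _ dins; lia.
Qed.

(** * Products of prime powers below a bound, and Stewart's criterion *)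

Definition prime_prod (e : nat -> nat) (j : nat) : nat := \prod_(p < j | prime p) p ^ e p.

Lemma prime_prodS (e : nat -> nat) (j : nat) :
  prime_prod e j.+1 = prime_prod e j * (if prime j then j ^ e j else 1).
Proof. by rewrite /prime_prod big_mkcond big_ord_recr /= -big_mkcond. Qed.

Lemma prime_prod_gt0 (e : nat -> nat) (j : nat) : 0 < prime_prod e j.
Proof. by apply: prodn_cond_gt0 => p pp; rewrite expn_gt0 prime_gt0. Qed.

Lemma coprime_prime_prod (e : nat -> nat) (j p : nat) :
  prime p -> j <= p -> coprime (prime_prod e j) p.
Proof.
move=> pp jp; apply: (big_ind (fun x => coprime x p)); first exact: coprime1n.
  by move=> x y; rewrite coprimeMl => -> ->.
move=> i pi; rewrite coprimeXl // prime_coprime // dvdn_prime2 //.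
by rewrite neq_ltn (leq_trans (ltn_ord i)).
Qed.

(** Every prime factor of [d] is below [j] because [d] is, so each prime-power part of [d] divides
    the matching factor of the product. *)
Lemma dvdn_prime_prod (e : nat -> nat) (j d N : nat) :
  (forall p k, prime p -> p < j -> p ^ k %| N -> k <= e p) ->
  0 < d -> d %| N -> d < j -> d %| prime_prod e j.
Proof.
move=> H d0 dN dj; apply/dvdn_partP => // p; rewrite mem_primes => /and3P[pp _ pd].
have pj : p < j by apply: leq_ltn_trans dj; apply: dvdn_leq.
rewrite p_part /prime_prod (bigD1 (Ordinal pj)) //= dvdn_mulr // dvdn_exp2l //.
by apply: H => //; apply: dvdn_trans dN; apply: pfactor_dvdnn.
Qed.

Lemma complete_prime_prod (e : nat -> nat) (N P : nat) :
  practical N -> P <= N ->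
  (forall p k, prime p -> p < P -> p ^ k %| N -> k <= e p) ->
  forall j, j <= P -> complete (prime_prod e j) /\ j <= (sigma (prime_prod e j)).+1.
Proof.
move=> pN PN H.
(* This bound comes from the practical number [N] alone, not from the induction. For prime [j] it is
   the condition for adjoining [j ^ e j]; at [j = P] it serves the last factor [P]. *)
have bd j : j <= P -> j <= (sigma (prime_prod e j)).+1.
  move=> jP; apply: (practical_sigma_bound N) => //; first exact: prime_prod_gt0.
    exact: leq_trans jP PN.
  move=> d; apply: dvdn_prime_prod => p k pp pj; apply: H => //.
  exact: leq_trans pj jP.
elim=> [_|j IH jP]; (split; last exact: bd).
  rewrite /prime_prod big_ord0 => -[|[|i]] // _; first exact: divisor_sum0.
  by exists [:: 1].
have [cj lj] := IH (ltnW jP).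
rewrite prime_prodS; case: ifP => pj; last by rewrite muln1.
apply: complete_mul_pfactor => //; first exact: prime_prod_gt0.
exact: coprime_prime_prod.
Qed.

(** * Roots of the quadratic modulo coprime products *)

Import Order.TTheory GRing.Theory Num.Theory.
Local Open Scope ring_scope.

(** At [m = p ^ k] this is [solvable_mod a b c p k] by conversion; general moduli are needed for
    products of prime powers. *)
Definition root_mod (a b c : int) (m : nat) : Prop :=
  exists n : int, (m%:Z %| quad a b c n)%Z.

Lemma dvdz_quad_congr (a b c m n n' : int) :
  (m %| n - n')%Z -> (m %| quad a b c n)%Z = (m %| quad a b c n')%Z.
Proof.
move=> h; have -> : quad a b c n = quad a b c n' + (n - n') * (a * (n + n') + b).
  by rewrite /quad; ring.
by rewrite rpredDr // dvdz_mulr.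
Qed.

(** Exact Taylor expansion with increment [t * q(n)]. It serves as a Hensel step when [t] inverts
    [- q'(n)] modulo a prime, and as the source of factored values of [q] for fixed [t]. *)
Lemma quad_newton (a b c n t : int) :
  quad a b c (n + t * quad a b c n) =
  quad a b c n * (1 + t * (2 * a * n + b) + a * t ^+ 2 * quad a b c n).
Proof. by rewrite /quad; ring. Qed.

Lemma quad_discr (a b c n : int) :
  4 * a * quad a b c n = (2 * a * n + b) ^+ 2 - (b ^+ 2 - 4 * a * c).
Proof. by rewrite /quad; ring. Qed.

Lemma prime_coprimez (p : nat) (x : int) : prime p -> coprimez p x = ~~ (p %| x)%Z.
Proof. by move=> pp; rewrite dvdzE -prime_coprime. Qed.

Lemma prime_ndvdz_subr1 (p : nat) (x : int) : prime p -> (p %| x)%Z -> ~~ (p %| x - 1)%Z.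
Proof.
move=> pp px; apply/negP => h; have := rpredB px h.
by rewrite opprB addrC subrK dvdz1; case: (p) pp => [|[]].
Qed.

Lemma linear_root_mod (u v m : int) : coprimez u m -> exists x : int, (m %| u * x + v)%Z.
Proof.
move=> /coprimezP[[x y] /= h]; exists (- v * x).
have -> : u * (- v * x) + v = m * (v * y); last exact: dvdz_mulr.
suff : v * (x * u + y * m) = v by move=> {2}<-; ring.
by rewrite h mulr1.
Qed.

(** The window is one full period of residues modulo [L * S]. Its lower end makes [n] large, its
    upper end keeps [q(n)] of order [(L * S) ^ 2]. *)
Lemma chinese_nat (L S : nat) (x y : int) :
  (0 < L * S)%N -> coprime L S ->
  exists n : nat, [/\ (L * S <= n < 2 * (L * S))%N, (L %| n%:Z - x)%Z & (S %| n%:Z - y)%Z].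
Proof.
move=> LS0 cLS; pose z := zchinese L S x y.
have cz : coprimez L S by [].
pose r := (z %% (L * S)%N)%Z.
have r0 : 0 <= r by apply: modz_ge0; lia.
have rlt : r < (L * S)%N by apply: ltz_pmod; lia.
have rz (d w : int) : (d %| (L * S)%N%:Z)%Z -> (d %| z - w)%Z ->
    (d %| ((L * S)%N + `|r|)%N%:Z - w)%Z.
  move=> dd; rewrite PoszD gez0_abs // => zw.
  have -> : (L * S)%N%:Z + r - w =
      (z - w) + (L * S)%N%:Z * (1 - (z %/ (L * S)%N)%Z).
    by rewrite {1}(divz_eq z (L * S)%N) -/r; ring.
  by rewrite rpredDr // dvdz_mulr.
exists (L * S + `|r|)%N; split; first by lia.
  by apply: rz; rewrite ?PoszM ?dvdz_mulr // -eqz_mod_dvd; apply/eqP; apply: zchinese_modl.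
by apply: rz; rewrite ?PoszM ?dvdz_mull // -eqz_mod_dvd; apply/eqP; apply: zchinese_modr.
Qed.

Lemma root_modM (a b c : int) (L S : nat) :
  (0 < L * S)%N -> coprime L S ->
  root_mod a b c L -> root_mod a b c S -> root_mod a b c (L * S).
Proof.
move=> LS0 cLS [x hx] [y hy]; have [n [_ nx ny]] := chinese_nat L S x y LS0 cLS.
exists n%:Z; rewrite PoszM Gauss_dvdz //.
by rewrite (dvdz_quad_congr _ _ _ _ _ _ nx) hx (dvdz_quad_congr _ _ _ _ _ _ ny).
Qed.

Lemma root_mod_prime_prod (a b c : int) (e : nat -> nat) (P : nat) :
  (forall p, prime p -> (p < P)%N -> root_mod a b c (p ^ e p)) ->
  root_mod a b c (prime_prod e P).
Proof.
elim: P => [|P IH] H; first by rewrite /prime_prod big_ord0; exists 0; rewrite dvd1z.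
have h : root_mod a b c (prime_prod e P).
  by apply: IH => p pp pP; apply: H => //; apply: ltnW.
rewrite prime_prodS; case: ifP => pP; last by rewrite muln1.
apply: root_modM => //; last exact: H.
  by rewrite muln_gt0 prime_prod_gt0 expn_gt0 prime_gt0.
by rewrite coprimeXr // coprime_prime_prod.
Qed.

(** * Hensel lifting and a prime with roots modulo all its powers *)

Lemma mq_infinite_lift (a b c : int) (p : nat) (n : int) :
  prime p -> (p %| quad a b c n)%Z -> ~~ (p %| 2 * a * n + b)%Z -> mq_infinite a b c p.
Proof.
move=> pp pq pq' k.
(* Keeping [x] congruent to [n] modulo [p] keeps the derivative at [x] invertible, so the next lift
   is possible. *)
suff [x [hx _]] : exists x, ((p ^ k.+1)%N%:Z %| quad a b c x)%Z /\ (p%:Z %| x - n)%Z.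
  by exists x; apply: dvdz_trans hx; rewrite expnS PoszM dvdz_mull.
elim: k => [|k [x [hx hn]]]; first by exists n; rewrite expn1 subrr dvdz0.
have [t ht] : exists t : int, (p%:Z %| (2 * a * x + b) * t + 1)%Z.
  apply: linear_root_mod; rewrite coprimez_sym.
  have <- : (2 * a * n + b) + 2 * a * (x - n) = 2 * a * x + b by ring.
  by rewrite prime_coprimez // rpredDr // dvdz_mull.
have px : (p%:Z %| quad a b c x)%Z.
  by apply: dvdz_trans hx; rewrite expnS PoszM dvdz_mulr.
exists (x + t * quad a b c x); rewrite quad_newton expnSr PoszM; split.
  apply: dvdz_mul => //.
  have -> : 1 + t * (2 * a * x + b) = (2 * a * x + b) * t + 1 by ring.
  by rewrite rpredD // dvdz_mull.
have -> : x + t * quad a b c x - n = (x - n) + t * quad a b c x by ring.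
by rewrite rpredD // dvdz_mull.
Qed.

Lemma exists_mq_infinite (a b c : int) : 0 < a ->
  exists2 p, prime p & mq_infinite a b c p.
Proof.
move=> a0; pose D := b ^+ 2 - 4 * a * c.
have [D0|Dn0] := eqVneq D 0.
  (* With zero discriminant, [4 * a * q(x)] is the square of [2 * a * x + b]; any prime not dividing
     [2 * a] works, and [2 * a + 1] supplies one. *)
  pose p := pdiv `|(2 * a + 1)%R|%N; have pp : prime p by apply: pdiv_prime; lia.
  have pd : (p %| 2 * a + 1)%Z by apply: pdiv_dvd.
  have c2a : coprimez (2 * a) p.
    rewrite coprimez_sym prime_coprimez //; apply: contraL pd => h.
    by rewrite rpredDl // dvdz1; case: (p) pp => [|[]].
  exists p => // k.
  have [x hx] : exists x, ((p ^ k)%N%:Z %| 2 * a * x + b)%Z.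
    by apply: linear_root_mod; rewrite coprimez_sym; apply: coprimeXl; rewrite coprimez_sym in c2a.
  exists x; have : ((p ^ k)%N%:Z %| 2 * a * (2 * quad a b c x))%Z.
    have -> : 2 * a * (2 * quad a b c x) = 4 * a * quad a b c x by ring.
    by rewrite quad_discr -/D D0 subr0 expr2 dvdz_mulr.
  rewrite Gauss_dvdzr; last by apply: coprimeXl; rewrite coprimez_sym in c2a.
  rewrite Gauss_dvdzr //; apply: coprimeXl.
  by move: c2a; rewrite coprimezMl => /andP[]; rewrite coprimez_sym.
(* Modulo a prime factor of [s], the inverse of [2 * a] is a square root of [D]. Solving
   [2 * a * x + b = 1 / (2 * a)] gives a root with invertible derivative. *)
pose s := 4 * a ^+ 2 * D - 1.
pose p := pdiv `|s|%N.
have pp : prime p.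
  have un0 : a ^+ 2 * D != 0 by rewrite mulf_neq0 // expf_neq0 // lt0r_neq0.
  by apply: pdiv_prime; rewrite /s -mulrA; move: (a ^+ 2 * D) un0; lia.
have ps : (p %| s)%Z by apply: pdiv_dvd.
have cp : coprimez p (2 * a).
  rewrite prime_coprimez //; apply: contraL ps => h.
  have -> : s = 2 * a * (2 * a * D) - 1 by rewrite /s; ring.
  by rewrite prime_ndvdz_subr1 // dvdz_mulr.
have [x hx] : exists x, (p %| 2 * a * (2 * a) * x + (2 * a * b - 1))%Z.
  by apply: linear_root_mod; rewrite coprimez_sym coprimezMr cp.
have px : (p %| 2 * a * (2 * a * x + b) - 1)%Z.
  by have -> : 2 * a * (2 * a * x + b) - 1 = 2 * a * (2 * a) * x + (2 * a * b - 1) by ring.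
exists p => //; apply: (@mq_infinite_lift _ _ _ _ x) => //; last first.
  apply: contraL px => h.
  by rewrite prime_ndvdz_subr1 // dvdz_mull.
(* The multiplier [2 * (2 * a) ^ 3] is prime to [p] and turns [q(x)] into [(v - 1) * (v + 1) - s],
   where [v = 2 * a * (2 * a * x + b)]. *)
rewrite -(@Gauss_dvdzr _ (2 * a)) // -(@Gauss_dvdzr _ (2 * a)) //.
rewrite -(@Gauss_dvdzr _ (2 * a)) // -(@Gauss_dvdzr _ 2); last first.
  by move: cp; rewrite coprimezMr => /andP[].
have -> : 2 * (2 * a * (2 * a * (2 * a * quad a b c x))) =
    (2 * a * (2 * a * x + b) - 1) * (2 * a * (2 * a * x + b) + 1) - s.
  have := quad_discr a b c x; rewrite -/D => e.
  have -> : 2 * (2 * a * (2 * a * (2 * a * quad a b c x))) =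
     (2 * a) ^+ 2 * (4 * a * quad a b c x) by ring.
  by rewrite e /s; ring.
by rewrite rpredB ?dvdz_mulr.
Qed.

(** * Size estimates and the auxiliary modulus *)

Lemma coprimez_subM1 (u w : int) : coprimez (u * w - 1) u.
Proof. by apply/coprimezP; exists (- 1, w) => /=; ring. Qed.

Lemma quad_gt (a b c n : int) :
  0 < a -> 4 * (`|a| + `|b| + `|c|) <= n -> 2 * a * n + b < quad a b c n.
Proof.
move=> a0 hn; rewrite /quad -subr_gt0.
have -> : a * n ^+ 2 + b * n + c - (2 * a * n + b) = n * (a * (n - 2) + b) + (c - b) by ring.
have h : n - 2 + b <= a * (n - 2) + b by rewrite lerD2r; nia.
have : n * (n - 2 + b) <= n * (a * (n - 2) + b) by apply: ler_wpM2l => //; lia.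
have : n * 1 <= n * (n - 2 + b) by apply: ler_wpM2l; lia.
lia.
Qed.

Lemma quad_le (a b c n R : int) :
  0 <= n <= 2 * R -> 1 <= R -> quad a b c n <= 4 * (`|a| + `|b| + `|c|) * R ^+ 2.
Proof.
move=> /andP[n0 nR] R1; rewrite /quad.
have RR : R <= R ^+ 2 by nia.
have n2 : n ^+ 2 <= 4 * R ^+ 2 by nia.
have h1 : a * n ^+ 2 <= `|a| * (4 * R ^+ 2).
  apply: le_trans (_ : `|a| * n ^+ 2 <= _); last by rewrite ler_wpM2l.
  by rewrite ler_wpM2r ?ler_norm ?sqr_ge0.
have h2 : b * n <= `|b| * (4 * R ^+ 2).
  apply: le_trans (_ : `|b| * n <= _); first by rewrite ler_wpM2r ?ler_norm.
  by rewrite ler_wpM2l //; lia.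
have h3 : c <= `|c| * (4 * R ^+ 2).
  by apply: le_trans (ler_norm c) _; rewrite ler_peMr //; lia.
lia.
Qed.

Lemma newton_modulus (a b c : int) (K : nat) :
  0 < a -> b ^+ 2 - 4 * a * c != 0 -> (0 < K)%N ->
  exists (t : int) (S : nat) (beta : int),
    [/\ 0 < t /\ t + a * t ^+ 2 <= S%:Z ^+ 2, 4 * (`|a| + `|b| + `|c|) <= S%:Z,
      coprime S K, (S%:Z %| quad a b c beta)%Z & (S%:Z %| 1 + t * (2 * a * beta + b))%Z].
Proof.
set D := b ^+ 2 - 4 * a * c => a0 D0 K0.
pose A : int := `|a| + `|b| + `|c|.
have aA : a <= A by rewrite /A; lia.
have A1 : 1 <= A by lia.
(* Since [2 * a], [2] and [K] divide [t], the modulus [S] is prime to [2 * a * t], [2 * t] and [K].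
   The factor [A] makes [t] large enough for the size bounds. *)
pose t : int := 4 * a * A * K%:Z.
have tA : 4 * A <= t.
  have h : 1 <= a * K%:Z by nia.
  have -> : t = 4 * A * (a * K%:Z) by rewrite /t; ring.
  by rewrite ler_peMr //; lia.
pose S := `|(t ^+ 2 * D - 1)%R|%N.
have St : t ^+ 2 - 1 <= S%:Z.
  rewrite /S abszE; have : 1 <= t ^+ 2 by apply: exprn_ege1; lia.
  move: (t ^+ 2) D0 => u; clear; clearbody D => D0 u1; have [D1|D1] : 1 <= D \/ D <= -1 by lia.
    have : u * 1 <= u * D by rewrite ler_wpM2l //; lia.
    lia.
  have : u * D <= u * -1 by rewrite ler_wpM2l //; lia.
  lia.
have cS (u w : int) : t ^+ 2 * D = u * w -> coprimez S%:Z u.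
  by move=> e; have := coprimez_subM1 u w; rewrite -e.
have S1 : (S%:Z %| t ^+ 2 * D - 1)%Z by rewrite dvdzE.
have cS1 : coprimez S%:Z (2 * a * t).
  by apply: (cS _ (2 * A * K%:Z * D)); rewrite expr2 {1}/t; ring.
have cS2 : coprimez S%:Z (2 * t).
  by apply: (cS _ (2 * a * A * K%:Z * D)); rewrite expr2 {1}/t; ring.
have cSK : coprimez S%:Z K.
  by apply: (cS _ (4 * a * A * t * D)); rewrite expr2 {1}/t; ring.
have [beta hb] : exists x : int, (S%:Z %| 2 * a * t * x + (t * b + 1))%Z.
  by apply: linear_root_mod; rewrite coprimez_sym.
exists t, S, beta.
have Sq : (S%:Z %| quad a b c beta)%Z.
  rewrite -(Gauss_dvdzr _ cS2) -(Gauss_dvdzr _ cS1).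
  have -> : 2 * a * t * (2 * t * quad a b c beta) = t ^+ 2 * (4 * a * quad a b c beta) by ring.
  rewrite quad_discr -/D.
  have -> : t ^+ 2 * ((2 * a * beta + b) ^+ 2 - D) =
     (2 * a * t * beta + (t * b + 1)) * (t * (2 * a * beta + b) - 1) - (t ^+ 2 * D - 1) by ring.
  by rewrite rpredB // dvdz_mulr.
have e : 1 + t * (2 * a * beta + b) = 2 * a * t * beta + (t * b + 1) by ring.
rewrite e; split=> //; clear - a0 aA A1 tA St; clearbody t S.
  split; first by lia.
  have tS : t * (t - 1) <= S%:Z by nia.
  apply: (@le_trans _ _ ((t * (t - 1)) ^+ 2)); last first.
    by rewrite ler_pXn2r // nnegrE ?mulr_ge0; lia.
  have -> : (t * (t - 1)) ^+ 2 = t ^+ 2 * (t - 1) ^+ 2 by ring.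
  apply: (@le_trans _ _ (t ^+ 2 * (a + 1))); first by nia.
  by rewrite ler_wpM2l ?sqr_ge0 //; nia.
have : t * 2 <= t * t by rewrite ler_wpM2l //; lia.
lia.
Qed.

(** * Practical values from the factorization of [q(n + t q(n))] *)

Lemma practical_newton (a b c t : int) (L S n : nat) :
  0 < a -> 0 < t -> t + a * t ^+ 2 <= S%:Z ^+ 2 -> 4 * (`|a| + `|b| + `|c|) <= S%:Z ->
  practical L -> (S <= L)%N -> (L * S <= n < 2 * (L * S))%N ->
  (L%:Z * S%:Z %| quad a b c n)%Z ->
  (S%:Z %| 1 + t * (2 * a * n%:Z + b) + a * t ^+ 2 * quad a b c n)%Z ->
  exists m N : nat, [/\ quad a b c m%:Z = N%:Z, (n < N)%N & practical N].
Proof.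
pose A : int := `|a| + `|b| + `|c|; rewrite -/A => a0 t0 tS AS pL SL nLS.
move=> /dvdzP[x qE] /dvdzP[z yE].
have aA : a <= A by rewrite /A; lia.
have R0 : 0 < L%:Z * S%:Z by nia.
have qgt : 2 * a * n%:Z + b < quad a b c n by apply: quad_gt => //; rewrite -/A; nia.
have qle : quad a b c n <= 4 * A * (L%:Z * S%:Z) ^+ 2 by apply: quad_le; lia.
have nq : n%:Z <= 2 * a * n%:Z + b.
  have : 1 * n%:Z <= a * n%:Z by rewrite ler_wpM2r //; lia.
  have : `|b| <= n%:Z by rewrite /A in AS; nia.
  by rewrite -mulrA; move: (a * n%:Z); lia.
have [m [mE]] : exists m : nat, m%:Z = n%:Z + t * quad a b c n.
  have : 0 <= t * quad a b c n by rewrite mulr_ge0; lia.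
  by exists `|(n%:Z + t * quad a b c n)%R|%N; lia.
have := quad_newton a b c n t; rewrite -mE.
move: (quad a b c n) qE qgt qle yE => q qE qgt qle.
set y := 1 + _ + _ => yE mqE.
have q0 : 0 < q by lia.
have S0 : 0 < S%:Z by lia.
have x_gt0 : 0 < x by rewrite -(pmulr_lgt0 _ R0) -qE.
(* Here [q <= 4 * A * (L * S) ^ 2 <= S * (L * S) ^ 2], and [q = x * (L * S)]. *)
have x_le : x <= L%:Z * S%:Z * S%:Z.
  rewrite -(ler_pM2r R0) -qE; apply: le_trans qle _; rewrite expr2 mulrA ler_pM2r //.
  by rewrite mulrC ler_pM2l.
have y1 : 1 <= y.
  have : 0 <= t * (2 * a * n%:Z + b) by rewrite mulr_ge0; lia.
  have : 0 <= a * t ^+ 2 * q by rewrite !mulr_ge0 ?sqr_ge0; lia.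
  rewrite /y; lia.
have z_gt0 : 0 < z by rewrite -(pmulr_lgt0 _ S0) -yE; lia.
(* As [q'(n) + 1 <= q] and [1 <= t], the terms [1 + t * q'(n)] are at most [t * q]. *)
have y_le : y <= S%:Z ^+ 2 * q.
  apply: (@le_trans _ _ ((t + a * t ^+ 2) * q)); last by rewrite ler_wpM2r //; lia.
  rewrite mulrDl /y lerD2r.
  have : t * (2 * a * n%:Z + b + 1) <= t * q by rewrite ler_wpM2l; lia.
  lia.
have z_le : z <= L%:Z * S%:Z * S%:Z * x.
  rewrite -(ler_pM2r S0) -yE; apply: le_trans y_le _; rewrite qE le_eqVlt; apply/orP; left.
  by apply/eqP; ring.
have nlt : n%:Z < q * y by apply: lt_le_trans (_ : q <= _); [lia|rewrite ler_peMr //; lia].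
have qyE : q * y = (L * S * S * `|x| * `|z|)%N%:Z.
  by rewrite qE yE !PoszM !gez0_abs ?ltW //; ring.
exists m, (L * S * S * `|x| * `|z|)%N; split; [by rewrite mqE|by lia|].
clear - pL SL S0 x_gt0 x_le z_gt0 z_le.
apply: practical_mul; last by lia.
apply: practical_mul; last by lia.
apply: practical_mul; last by apply/andP; split; [lia|nia].
by apply: practical_mul => //; lia.
Qed.

Lemma practical_newton_discr0 (a b c : int) (L S n : nat) :
  0 < a -> b ^+ 2 - 4 * a * c = 0 -> 6 * (`|a| + `|b| + `|c|) <= S%:Z ->
  practical L -> (S <= L)%N -> (L * S <= n < 2 * (L * S))%N ->
  (L%:Z %| quad a b c n)%Z -> (S%:Z %| 2 * a * n%:Z + b + 1)%Z ->
  exists m N : nat, [/\ quad a b c m%:Z = N%:Z, (n < N)%N & practical N].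
Proof.
pose A : int := `|a| + `|b| + `|c|; rewrite -/A => a0 D0 AS pL SL nLS.
move=> /dvdzP[x qE] /dvdzP[z yE].
have aA : a <= A by rewrite /A; lia.
have S0 : (0 < S)%N by lia.
have R0 : 0 < L%:Z * S%:Z by nia.
have qgt : 2 * a * n%:Z + b < quad a b c n by apply: quad_gt => //; rewrite -/A; nia.
have nq : n%:Z <= 2 * a * n%:Z + b.
  have : 1 * n%:Z <= a * n%:Z by rewrite ler_wpM2r //; lia.
  have : `|b| <= n%:Z by rewrite /A in AS; nia.
  by rewrite -mulrA; move: (a * n%:Z); lia.
have [m mE] : exists m : nat, m%:Z = n%:Z + 2 * quad a b c n.
  by exists `|(n%:Z + 2 * quad a b c n)%R|%N; lia.
have qD : 4 * a * quad a b c n = (2 * a * n%:Z + b) ^+ 2 by rewrite quad_discr D0 subr0.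
(* The constant 6 allows [4 * A * L * S] for [2 * a * n], as [n < 2 * L * S], and [2 * A] for
   [b + 1]. *)
have le_y : 2 * a * n%:Z + b + 1 <= L%:Z * S%:Z * S%:Z.
  apply: (@le_trans _ _ (6 * A * (L%:Z * S%:Z))); last by rewrite mulrC ler_pM2l.
  have : a * n%:Z <= A * (2 * (L%:Z * S%:Z)) by apply: ler_pM; lia.
  have : A * 1 <= A * (L%:Z * S%:Z) by rewrite ler_wpM2l; lia.
  rewrite -!mulrA; move: (a * n%:Z) (L%:Z * S%:Z) => u v; rewrite /A; lia.
have := quad_newton a b c n 2; rewrite -mE.
have -> : 1 + 2 * (2 * a * n%:Z + b) + a * 2 ^+ 2 * quad a b c n =
    (2 * a * n%:Z + b + 1) ^+ 2.
  have -> : a * 2 ^+ 2 * quad a b c n = 4 * a * quad a b c n by ring.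
  by rewrite qD; ring.
move: (quad a b c n) (2 * a * n%:Z + b) qE qgt qD le_y yE nq => q y qE qy qD le_y yE nq mqE.
have y0 : 0 < y by apply: lt_le_trans nq; lia.
have x_gt0 : 0 < x by nia.
have z_gt0 : 0 < z by nia.
(* Now [y] is [q'(n)]. Primes of [x] divide [y ^ 2 = 4 * a * q], primes of [z] divide [y + 1]; so
   their size is under control although [x * z ^ 2] may be large. *)
have small (p : nat) : (p %| y)%Z || (p %| y + 1)%Z -> (p <= L * S * S)%N.
  move=> h; have : (p <= `|y|)%N || (p <= `|(y + 1)%R|)%N.
    by case/orP: h => h; apply/orP; [left|right]; apply: dvdn_leq h; lia.
  by clear - le_y y0; lia.
have qyE : q * (y + 1) ^+ 2 = (L * S * S * (`|x| * `|z| ^ 2))%N%:Z.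
  by rewrite qE yE !PoszM !gez0_abs ?ltW //; ring.
exists m, (L * S * S * (`|x| * `|z| ^ 2))%N; split; first by rewrite mqE.
  have : q * 1 <= q * (y + 1) ^+ 2 by rewrite ler_wpM2l ?exprn_ege1; lia.
  lia.
apply: practical_mul_smooth.
- apply: practical_mul; last by rewrite S0 leq_pmull // pL.1.
  by apply: practical_mul; rewrite ?S0.
- by rewrite muln_gt0 expn_gt0; lia.
move=> p pp; rewrite Euclid_dvdM // Euclid_dvdX // andbT => /orP[px|pz]; apply: small.
  have : (p%:Z %| y ^+ 2)%Z by rewrite -qD qE mulrA dvdz_mulr // dvdz_mull.
  by rewrite dvdzE abszX Euclid_dvdX // andbT => py; apply/orP; left.
by apply/orP; right; rewrite yE dvdz_mulr.
Qed.

Lemma practical_quad_unbounded (a b c : int) (M P B : nat) :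
  0 < a -> (0 < M)%N -> prime P -> practical (M * P) ->
  (forall k, root_mod a b c (M * P ^ k)) ->
  exists n N : nat, [/\ quad a b c n%:Z = N%:Z, (B < N)%N & practical N].
Proof.
move=> a0 M0 pP pMP root; have P0 := prime_gt0 pP.
have pick_n (S : nat) (beta : int) : (0 < S)%N -> coprime S (M * P) ->
    exists L n : nat, [/\ practical L, (S <= L)%N, (B < L)%N, coprime L S &
      [/\ (L * S <= n < 2 * (L * S))%N, (L %| quad a b c n)%Z & (S %| n%:Z - beta)%Z]].
  (* This exponent makes [L] exceed both [B] and [S]. *)
  move=> S0 cS; pose k := (B + S)%N; pose L := (M * P ^ k.+1)%N.
  have kL : (k < L)%N.
    apply: leq_trans (ltn_expl k (prime_gt1 pP)) _.
    by rewrite /L expnS mulnA leq_pmull // muln_gt0 M0.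
  have cLS : coprime L S.
    move: cS; rewrite coprimeMr => /andP[cM cP].
    by rewrite coprimeMl coprime_pexpl // !(coprime_sym _ S); apply/andP.
  have [x hx] := root k.+1.
  have [|n [nLS nx nb]] := chinese_nat L S x beta _ cLS.
    by rewrite muln_gt0 S0 (leq_trans _ kL).
  exists L, n; split; rewrite ?(dvdz_quad_congr _ _ _ _ _ _ nx) //.
  - exact: practical_mul_expn.
  - by apply: leq_trans (ltnW kL); apply: leq_addl.
  - by apply: leq_trans kL; rewrite ltnS leq_addr.
have BN (L S n N : nat) : (0 < S)%N -> (B < L)%N -> (L * S <= n < 2 * (L * S))%N ->
    (n < N)%N -> (B < N)%N.
  move=> S0 BL /andP[h _] nN; apply: leq_trans BL _; apply: leq_trans (ltnW nN).
  by apply: leq_trans h; rewrite leq_pmulr.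
have [D0|D0] := eqVneq (b ^+ 2 - 4 * a * c) 0.
  (* The modulus [S = 2 * a * u + 1] is then prime to [2 * a] and to [M * P], and exceeds
     [6 * A]. *)
  pose A : int := `|a| + `|b| + `|c|; pose u : int := 3 * A * (M * P)%N%:Z.
  have MP0 : 0 < (M * P)%N%:Z by rewrite ltz_nat muln_gt0 M0.
  have A1 : 1 <= A by rewrite /A; lia.
  have Au : 6 * A <= 2 * a * u.
    have -> : 2 * a * u = 6 * A * (a * (M * P)%N%:Z) by rewrite /u; ring.
    by rewrite ler_peMr; [|lia|nia].
  pose S := `|(2 * a * u + 1)%R|%N.
  have SE : S%:Z = 2 * a * u + 1 by rewrite /S abszE ger0_norm //; lia.
  have cS v w : 2 * a * u = v * w -> coprimez S%:Z v.
    by move=> e; apply/coprimezP; exists (1, - w) => /=; rewrite SE e; ring.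
  have [beta hb] : exists x : int, (S%:Z %| 2 * a * x + (b + 1))%Z.
    by apply: linear_root_mod; rewrite coprimez_sym; apply: (cS _ u).
  have S0 : (0 < S)%N by lia.
  have [||L [n [pL SL BL _ [nLS Lq Sn]]]] := pick_n S beta => //.
    by apply: (cS (M * P)%N%:Z (6 * a * A)); rewrite /u; ring.
  have [||m [N [mN nN pN]]] := practical_newton_discr0 a b c L S n a0 D0 _ pL SL nLS Lq.
  - by apply: le_trans Au _; rewrite SE lerDl.
  - have -> : 2 * a * n%:Z + b + 1 = 2 * a * (n%:Z - beta) + (2 * a * beta + (b + 1)) by ring.
    by rewrite rpredD // dvdz_mull.
  by exists m, N; split; rewrite ?(BN L S n N).
have [|t [S [beta [[t0 tS] AS cS Sq Sy]]]] := newton_modulus a b c (M * P) a0 D0.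
  by rewrite muln_gt0 M0.
have S0 : (0 < S)%N by lia.
have [L [n [pL SL BL cLS [nLS Lq Sn]]]] := pick_n S beta S0 cS.
have Sqn : (S%:Z %| quad a b c n)%Z by rewrite (dvdz_quad_congr _ _ _ _ _ _ Sn).
have [||m [N [mN nN pN]]] := practical_newton a b c t L S n a0 t0 tS AS pL SL nLS.
- by rewrite Gauss_dvdz // Lq.
- have -> : 1 + t * (2 * a * n%:Z + b) + a * t ^+ 2 * quad a b c n =
    1 + t * (2 * a * beta + b) + (2 * a * t * (n%:Z - beta) + a * t ^+ 2 * quad a b c n) by ring.
  by rewrite rpredD // rpredD // dvdz_mull.
by exists m, N; split; rewrite ?(BN L S n N).
Qed.

(* The least prime with unbounded exponent, and the equivalence *)
Local Close Scope ring_scope.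

Theorem theorem2p5 (a b c : int) (ha : (0 < a)%R) :
  exists P : nat,
    [/\ prime P, mq_infinite a b c P,
        (forall p : nat, prime p -> p < P -> ~ mq_infinite a b c p) &
        forall e : nat -> nat,
          (forall p : nat, prime p -> p < P -> mq_is a b c p (e p)) ->
          ((forall B : nat, exists n N : nat,
               [/\ quad a b c (Posz n) = Posz N, B < N & practical N])
           <-> practical ((\prod_(p < P | prime p) p ^ e p) * P))].
Proof.
have [P [pP mqP minP]] : exists P, [/\ prime P, mq_infinite a b c P &
    forall p : nat, prime p -> p < P -> ~ mq_infinite a b c p].
  have [p] := exists_mq_infinite a b c ha; elim/ltn_ind: p => p IH pp mp.
  (* [mq_infinite] comes with no decision procedure, so the descent to a least prime uses excluded
     middle. *)
  have [[p' [pp' lt mp']]|no] := classic (exists p', [/\ prime p', p' < p & mq_infinite a b c p']).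
    exact: IH lt pp' mp'.
  by exists p; split=> // p' pp' lt mp'; apply: no; exists p'.
exists P; split=> // e he; rewrite -/(prime_prod e P).
have M0 := prime_prod_gt0 e P; have P0 := prime_gt0 pP.
split=> [inf|pMP B].
  have [n [N [qN PN pN]]] := inf P.
  have [|cM PM] := complete_prime_prod e N P pN (ltnW PN) _ P (leqnn P).
    by move=> p k pp pP' pk; apply: (he p pp pP').2; exists (Posz n); rewrite qN.
  apply: complete_practical; first by rewrite muln_gt0 M0.
  (* The final factor [P] is adjoined like the smaller primes, with exponent 1. *)
  rewrite -[P in _ * P]expn1; apply: complete_mul_pfactor => //.
  exact: coprime_prime_prod.
apply: practical_quad_unbounded (pMP) _ => // k.
apply: root_modM; rewrite ?muln_gt0 ?M0 ?expn_gt0 ?P0 //.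
- by rewrite coprimeXr // coprime_prime_prod.
- by apply: root_mod_prime_prod => p pp pP'; apply: (he p pp pP').1.
- exact: mqP.
Qed.
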